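(* Let $r\ge 2$ and $2\le \ell_1\le \cdots\le \ell_r$ be integers. Then $$F\big(n,\mathcal L^{(r)}_{\ell_1,\dots,\ell_r}\big)\ge n^{1-\frac{\ell_1+\cdots+\ell_r-r}{\ell_1\cdots\ell_r-1}-o(1)},$$ where $o(1)$ denotes a quantity tending to $0$ as $n\to\infty$ (with $r,\ell_1,\dots,\ell_r$ fixed).
   Context: For an abelian group $G$, a set $A\subset G$ is called $\mathcal L^{(r)}_{\ell_1,\dots,\ell_r}$-free if $A$ contains no sumset $L_1+\cdots+L_r=\{\lambda_1+\cdots+\lambda_r:\lambda_i\in L_i\}$ with $L_i\subset G$ and $|L_i|=\ell_i$ for $i=1,\dots,r$. (The sums need not be pairwise distinct.) $F\big(n,\mathcal L^{(r)}_{\ell_1,\dots,\ell_r}\big)$ denotes the largest size of an $\mathcal L^{(r)}_{\ell_1,\dots,\ell_r}$-free set of integers contained in $\{1,\dots,n\}$ (here $G=\mathbb Z$). *)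

(* Defs.v *)
(* Written over MathComp and MathComp-Analysis. *)
From mathcomp Require Import all_boot all_order all_algebra finmap.
From mathcomp Require Import all_classical all_reals all_analysis.
Set Implicit Arguments.
Unset Strict Implicit.
Unset Printing Implicit Defensive.
Import Order.TTheory GRing.Theory Num.Theory.
Local Open Scope ring_scope.

(* L_1 + ... + L_r, as a set: the sums need not be pairwise distinct.
   The indices 1, ..., r are shifted to 0, ..., r - 1. *)
Definition sumset (G : zmodType) (r : nat) (L : 'I_r -> {fset G}) : set G :=
  [set x | exists lambda : 'I_r -> G,
    (forall i, lambda i \in L i) /\ x = \sum_(i < r) lambda i]%classic.

Definition sumset_free (G : zmodType) (r : nat) (l : 'I_r -> nat)
    (A : set G) : Prop :=
  ~ exists L : 'I_r -> {fset G},
      (forall i, #|` L i|%fset = l i) /\ (sumset L `<=` A)%classic.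

Definition int_interval (n : nat) : {fset int} :=
  [fset k%:Z | k in iota 1 n]%fset.

(* The summands L_i of a forbidden sumset range over all of int, not only
   over subsets of {1, ..., n}. *)
Definition max_sumset_free (r : nat) (l : 'I_r -> nat) (n : nat) : nat :=
  (\max_(A <- fpowerset (int_interval n)
         | `[< sumset_free l [set` A]%classic >]) #|` A|%fset)%N.

(* Main.v *)
Require Import Defs.
From mathcomp Require Import all_boot all_order all_algebra finmap.
From mathcomp Require Import all_classical all_reals all_analysis.
From mathcomp Require Import zify ring lra.
Import Order.TTheory GRing.Theory Num.Theory.
Import numFieldNormedType.Exports.
Local Open Scope ring_scope.

(** Write P for the product of the l i, s for the sum of the l i - 1, and
    F(n) for the maximum to be bounded from below.

    A first attempt is the deletion method: keep each integer of [1, n] with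
    probability p, then remove one point from every sumset that survives.  If
    all sumsets had P distinct elements, there would be O(n^(1 + s)) of them (a
    base point, and the s differences from a base point of each summand), so
    that about p n - p^P O(n^(1 + s)) points would be left; taking p near
    n^(-s / (P - 1)) gives the exponent 1 - s / (P - 1).  The obstacle is
    that a degenerate sumset, with fewer than P elements, survives with much
    larger probability.

    Degenerate sumsets are excluded by deleting from a set B without 3-term
    arithmetic progressions instead of from [1, n].  If two representations
    sum u i = sum v i of a sum x differ at i, then exchanging u i and v i
    between them yields the elements x - d and x + d of the sumset, where
    d = v i - u i is nonzero; so x - d, x, x + d is a progression inside the
    sumset ([sumset_sums_inj]).  Hence every sumset inside B has P distinct
    elements.  Behrend's construction gives such a B with
    n^(1 - o(1)) elements ([behrend], [behrend_powR]), and this loss is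
    absorbed by the o(1) of the exponent.

    The deletion method is [alteration], with p = 1 / (q + 1) for an integer
    q; it is applied to the hypergraph whose edges are indexed by the base
    point and the differences ([edge_of_sumset], [card_edge_code]), with
    outcome [max_sumset_free_alteration].  Optimizing q gives the exponent
    with an arbitrarily small loss ([max_sumset_free_powR]). *)

(** * Sumsets in sets without 3-term progressions *)

Definition ap3_free {G : zmodType} (A : set G) : Prop :=
  forall x d : G, A (x - d) -> A x -> A (x + d) -> d = 0.

Lemma sub_ap3_free {G : zmodType} {A B : set G} :
  (A `<=` B)%classic -> ap3_free B -> ap3_free A.
Proof.
by move=> AB apB x d A1 A2 A3; apply: (apB x d); exact: AB.
Qed.

(** A coincidence of sums produces a progression: exchanging the i-th terms of
    the two representations moves the common sum by d = v i - u i, up in one of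
    them and down in the other. *)
Lemma sumset_sums_inj {G : zmodType} {A : set G} {r : nat}
    {L : 'I_r -> {fset G}} {u v : 'I_r -> G} :
  ap3_free A -> (sumset L `<=` A)%classic ->
  (forall i, u i \in L i) -> (forall i, v i \in L i) ->
  \sum_(i < r) u i = \sum_(i < r) v i -> forall i, u i = v i.
Proof.
move=> apA LA uL vL euv i; apply/eqP; rewrite eq_sym -subr_eq0; apply/eqP.
have swapE (f g : 'I_r -> G) :
    \sum_j (if j == i then g j else f j) = \sum_j f j + (g i - f i).
  rewrite (bigD1 i) //= eqxx [in RHS](bigD1 i) //=.
  rewrite (eq_bigr f) => [|j /negPf->//].
  by rewrite addrC [RHS]addrC addrA subrK addrC.
have inA (f g : 'I_r -> G) : (forall i, f i \in L i) ->
    (forall i, g i \in L i) -> A (\sum_j f j + (g i - f i)).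
  move=> fL gL; rewrite -swapE; apply: LA.
  by exists (fun j => if j == i then g j else f j); split => // j; case: ifP.
apply: (apA (\sum_j u j)); last exact: inA.
- by rewrite opprB [X in X + _]euv; exact: inA.
- by apply: LA; exists u.
Qed.

(** * Behrend's construction in a fixed dimension *)

Definition ints {n : nat} (A : {set 'I_n}) : set int :=
  [set x | exists2 a, a \in A & x = Posz a]%classic.

Lemma sum_digits_inj (b k : nat) (f g : nat -> nat) :
  (forall i, f i < b)%N -> (forall i, g i < b)%N ->
  (\sum_(i < k) f i * b ^ i = \sum_(i < k) g i * b ^ i)%N ->
  forall i, (i < k)%N -> f i = g i.
Proof.
elim: k f g => [//|k IH] f g fb gb.
have E (h : nat -> nat) : (\sum_(i < k.+1) h i * b ^ i
     = (\sum_(i < k) h i.+1 * b ^ i) * b + h 0)%N.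
  rewrite big_ord_recl expn0 muln1 addnC big_distrl /=; congr addn.
  by apply: eq_bigr => i _; rewrite -mulnA -expnSr.
rewrite !E => e.
have b0 : (0 < b)%N by apply: leq_ltn_trans (fb 0).
have e0 : f 0 = g 0.
  by have := congr1 (modn^~ b) e; rewrite !modnMDl !modn_small.
have eS : (\sum_(i < k) f i.+1 * b ^ i = \sum_(i < k) g i.+1 * b ^ i)%N.
  by have := congr1 (divn^~ b) e; rewrite !divnMDl // !divn_small // !addn0.
case=> [//|i] ik.
exact: (IH (fun i => f i.+1) (fun i => g i.+1)).
Qed.

Lemma sum_digits_lt (b k : nat) (f : nat -> nat) : (0 < b)%N ->
  (forall i, f i < b)%N -> (\sum_(i < k) f i * b ^ i < b ^ k)%N.
Proof.
move=> b0 fb; elim: k => [|k IH]; first by rewrite big_ord0.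
rewrite big_ord_recr /= expnS.
apply: (@leq_trans (b ^ k + f k * b ^ k)); first by rewrite ltn_add2r.
by rewrite -mulSn leq_mul2r fb orbT.
Qed.

Lemma pigeonhole_fiber {T : finType} (m : nat) (f : T -> nat) :
  (forall x, f x < m)%N ->
  exists c : nat, (#|T| <= m * #|[set x | f x == c]%SET|)%N.
Proof.
move=> fm; case: m fm => [|m] fm.
  exists 0%N; rewrite mul0n leqn0; apply/eqP/eq_card0 => x.
  by have := fm x.
have [c _ cmax] := @arg_maxnP 'I_m.+1 ord0 xpredT
  (fun c => #|[set x | f x == c]%SET|) isT.
exists (nat_of_ord c).
rewrite -[X in (X <= _)%N]sum1_card (partition_big (fun x => Ordinal (fm x)) xpredT) //=.
apply: (@leq_trans (\sum_(j < m.+1) #|[set x | f x == c]%SET|)); last first.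
  by rewrite sum_nat_const card_ord.
apply: leq_sum => j _; apply: leq_trans (cmax j isT).
rewrite sum1dep_card; apply: subset_leq_card.
by apply/fintype.subsetP => x; rewrite !inE => /eqP <-.
Qed.

(** Used with base b = 2 d: adding two vectors with digits below d then
    involves no carry, so that additive relations between values are
    relations between vectors. *)
Definition digits_value (b : nat) {k d : nat} (v : {ffun 'I_k -> 'I_d}) : nat :=
  (\sum_(i < k) v i * b ^ i)%N.

(** A sphere contains the midpoint of two of its points only if they coincide.
    The squared norms on the grid {0, ..., d - 1}^k take fewer than k d^2 values,
    so some sphere carries at least d^k / (k d^2) grid points. *)
Lemma behrend_sphere (k d : nat) : (0 < k)%N -> (0 < d)%N ->
  exists S : {set {ffun 'I_k -> 'I_d}},
    (d ^ k <= k * d ^ 2 * #|S|)%N /\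
    forall u v w, u \in S -> v \in S -> w \in S ->
      (digits_value (2 * d) u + digits_value (2 * d) w =
         2 * digits_value (2 * d) v)%N -> u = v.
Proof.
move=> k0 d0.
pose nrm (v : {ffun 'I_k -> 'I_d}) := (\sum_(i < k) v i ^ 2)%N.
have nrm_lt v : (nrm v < k * d ^ 2)%N.
  apply: (@leq_ltn_trans (\sum_(i < k) d.-1 ^ 2)%N).
    by apply: leq_sum => i _; rewrite leq_exp2r //; have := ltn_ord (v i); lia.
  by rewrite sum_nat_const card_ord ltn_mul2l k0 /= ltn_exp2r // prednK.
have [c hc] := pigeonhole_fiber _ nrm nrm_lt.
exists [set v | nrm v == c]%SET; split.
  by move: hc; rewrite card_ffun !card_ord.
move=> u v w; rewrite !inE => /eqP nu /eqP nv /eqP nw e.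
have dig i : (u i + w i = 2 * v i)%N.
  (* Digits indexed by all of nat, padded by 0 from k on. *)
  pose F (g : 'I_k -> nat) (j : nat) :=
    if insub j is Some j' then g j' else 0%N.
  have FE g (j : 'I_k) : F g j = g j by rewrite /F valK.
  rewrite -(FE (fun i => u i + w i)%N) -(FE (fun i => 2 * v i)%N).
  apply: (@sum_digits_inj (2 * d) k) => //.
  - move=> j; rewrite /F; case: insubP => [j' _ _|_]; last by lia.
    by have := ltn_ord (u j'); have := ltn_ord (w j'); lia.
  - move=> j; rewrite /F; case: insubP => [j' _ _|_]; last by lia.
    by have := ltn_ord (v j'); lia.
  move: e; rewrite /digits_value -big_split big_distrr /=.
  under eq_bigr do rewrite -mulnDl.
  under [X in _ = X -> _]eq_bigr do rewrite mulnA.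
  move=> e.
  by under eq_bigr do rewrite FE; rewrite e; under [RHS]eq_bigr do rewrite FE.
(* This is |u|^2 + |w|^2 = 2 |v|^2 + 2 |u - v|^2, for the midpoint v of u and w.
   One of the two truncated differences is 0, so their sum is |u i - v i|. *)
have para : (\sum_(i < k) (u i ^ 2 + w i ^ 2) =
   \sum_(i < k) (v i ^ 2 + v i ^ 2 + (((u i - v i) + (v i - u i)) ^ 2
    + ((u i - v i) + (v i - u i)) ^ 2)))%N.
  by apply: eq_bigr => i _; have := dig i; nia.
move: para; rewrite !big_split /= -/(nrm u) -/(nrm v) -/(nrm w).
rewrite nu nv nw => para.
move/eqP: para; rewrite -[X in X == _]addn0 eqn_add2l eq_sym addn_eq0.
move=> /andP[+ _].
rewrite sum_nat_eq0 => /forallP z; apply/ffunP => i; apply: val_inj.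
by have := z i; rewrite /= expn_eq0 /= andbT; lia.
Qed.

(** The grid size d is the largest one with (2 d)^k <= n.  By maximality
    n < (4 d)^k, so a sphere gives |B| >= n / (4^k k d^2), where
    d^2 <= n^(2 / k).  With k fixed this is a loss of 2 / k in the exponent,
    which is arbitrarily small for k large. *)
Lemma behrend (n k : nat) : (0 < k)%N -> (2 ^ k <= n)%N ->
  exists d : nat, exists B : {set 'I_n.+1},
    [/\ ap3_free (ints B),
        ord0 \notin B, (d ^ k <= n)%N &
        (n <= 4 ^ k * (k * d ^ 2 * #|B|))%N].
Proof.
move=> k0 n2.
have [d /andP[d0 dn] dmax] : exists2 d, (0 < d)%N && ((2 * d) ^ k <= n)%N &
    forall d', (0 < d')%N && ((2 * d') ^ k <= n)%N -> (d' <= d)%N.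
  have ex : exists d, (0 < d)%N && ((2 * d) ^ k <= n)%N by exists 1%N.
  have ub d : (0 < d)%N && ((2 * d) ^ k <= n)%N -> (d <= n)%N.
    case/andP=> d0; apply: leq_trans; apply: (@leq_trans (2 * d)); first lia.
    by rewrite -[X in (X <= _)%N]expn1 leq_pexp2l //; lia.
  by case: (ex_maxnP ex ub) => d; exists d.
have nlt : (n < (2 * d.+1) ^ k)%N.
  by rewrite ltnNge; apply/negP => h; have := dmax d.+1 h; rewrite ltnn.
have [S [cS apS]] := @behrend_sphere k d k0 d0.
have evlt (v : {ffun 'I_k -> 'I_d}) : (digits_value (2 * d) v < n)%N.
  apply: leq_trans dn.
  pose F (j : nat) := if insub j is Some j' then v j' : nat else 0%N.
  have -> : (digits_value (2 * d) v = \sum_(i < k) F i * (2 * d) ^ i)%N.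
    by apply: eq_bigr => i _; rewrite /F valK.
  apply: sum_digits_lt => [|j]; first lia.
  by rewrite /F; case: insubP => [j' _ _|_]; [have := ltn_ord (v j')|]; lia.
(* The shift by 1 makes the values positive. *)
pose f (v : {ffun 'I_k -> 'I_d}) : 'I_n.+1 := inord (digits_value (2 * d) v).+1.
have fE v : f v = (digits_value (2 * d) v).+1 :> nat by rewrite /f inordK // ltnS.
exists d, [set f v | v in S]; split.
- move=> x e [_ /imsetP[u uS ->] xu] [_ /imsetP[v vS ->] xv] [_ /imsetP[w wS ->] xw].
  suff uv : u = v by move: xu xv; rewrite uv; lia.
  by apply: (apS u v w) => //; move: xu xv xw; rewrite !fE; lia.
- by apply/imsetP => -[v _ /(congr1 val)] /=; rewrite fE.
- by apply: leq_trans dn; rewrite leq_exp2r //; lia.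
- rewrite card_in_imset; last first.
    by move=> u v uS vS /(congr1 val) /=; rewrite !fE => -[e];
      apply: (apS u v v) => //; lia.
  apply: (@leq_trans (4 ^ k * d ^ k)); last by rewrite leq_mul2l cS orbT.
  rewrite -expnMn; apply: (leq_trans (ltnW nlt)); rewrite leq_exp2r //; lia.
Qed.

(** * The deletion method for hypergraphs *)

Lemma card_coloring_mono (T : finType) (q : nat) (e : {set T}) :
  (#|[set f : {ffun T -> 'I_q.+1} | [forall x in e, f x == ord0]]| * q.+1 ^ #|e|
   = q.+1 ^ #|T|)%N.
Proof.
have -> : #|[set f : {ffun T -> 'I_q.+1} | [forall x in e, f x == ord0]]| =
  #|(family (fun x => if x \in e then pred1 (ord0 : 'I_q.+1) else predT))|.
  apply: eq_card => f; rewrite inE; apply/forallP/familyP => h x;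
    by have := h x; case: ifP => _; rewrite ?inE.
rewrite card_family foldrE big_map big_enum /=.
rewrite (eq_bigr (fun x => if x \in ~: e then q.+1 else 1)%N); last first.
  by move=> x _; rewrite inE; case: ifP => _ /=; rewrite ?card1 ?card_ord.
rewrite -big_mkcond /= prod_nat_const.
by rewrite -expnD addnC cardsC.
Qed.

Lemma exists_leq_of_sum {I : finType} (i0 : I) (F G : I -> nat) :
  (\sum_i F i <= \sum_i G i)%N -> exists i, (F i <= G i)%N.
Proof.
move=> h; apply/existsP; apply: contraT; rewrite negb_exists => /forallP lt.
have : (\sum_i (G i).+1 <= \sum_i F i)%N.
  by apply: leq_sum => i _; rewrite ltnNge.
move=> /leq_trans /(_ h); under eq_bigr do rewrite -addn1.
rewrite big_split /= sum1_card -[leqRHS]addn0 leq_add2l leqn0.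
by move=> /eqP /card0_eq /(_ i0).
Qed.

(** The probabilistic argument, as a count over all functions f : T -> 'I_q.+1:
    f^-1(0) is a random set of density 1 / (q + 1), which contains a given
    edge with at least k + 1 points with probability at most
    (q + 1)^-(k + 1).  For some f, the number of points of B in f^-1(0) minus the
    number of edges inside is at least its mean; one point of each of these
    edges is then deleted. *)
Lemma alteration {T J : finType} (x0 : T) (B : {set T}) (e : J -> {set T})
    (D : {set J}) (k q : nat) :
  (forall j, j \in D -> k < #|e j|)%N ->
  exists2 A : {set T}, A \subset B &
    (forall j, j \in D -> ~~ (e j \subset A)) /\
    (#|B| * q.+1 ^ k <= #|A| * q.+1 ^ k.+1 + #|D|)%N.
Proof.
move=> De; pose Q := q.+1.
pose Af (f : {ffun T -> 'I_Q}) := [set x in B | f x == ord0].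
pose Df f := [set j in D | e j \subset Af f].
have sumA : (Q * \sum_f #|Af f| = Q ^ #|T| * #|B|)%N.
  under eq_bigr do rewrite -sum1_card.
  rewrite (exchange_big_dep (mem B)) /=; last by move=> f x _; rewrite inE => /andP[].
  rewrite big_distrr /= [RHS]mulnC -sum_nat_const; apply: eq_bigr => x xB.
  rewrite -(card_coloring_mono _ q [set x]) cards1 expn1 mulnC; congr muln.
  rewrite -sum1dep_card; apply: eq_bigl => f.
  rewrite inE xB /=; apply/idP/forallP => [fx y|/(_ x)]; last by rewrite inE eqxx.
  by rewrite inE; apply/implyP => /eqP ->.
have sumD : (Q ^ k.+1 * \sum_f #|Df f| <= Q ^ #|T| * #|D|)%N.
  under eq_bigr do rewrite -sum1_card.
  rewrite (exchange_big_dep (mem D)) /=; last by move=> f x _; rewrite inE => /andP[].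
  rewrite big_distrr /= [leqRHS]mulnC -sum_nat_const; apply: leq_sum => j jD.
  rewrite -(card_coloring_mono _ q (e j)) mulnC leq_mul //; last first.
    by rewrite leq_pexp2l // De.
  rewrite sum1dep_card; apply: subset_leq_card; apply/fintype.subsetP => f.
  rewrite !inE => /andP[_ /fintype.subsetP h]; apply/forallP => x.
  by apply/implyP => /h; rewrite inE => /andP[].
have [f hf] : exists f, (#|B| * Q ^ k + Q ^ k.+1 * #|Df f|
                          <= #|Af f| * Q ^ k.+1 + #|D|)%N.
  pose i0 : {ffun T -> 'I_Q} := [ffun=> ord0].
  apply: (exists_leq_of_sum i0).
  rewrite !big_split /= !sum_nat_const card_ffun card_ord -/Q.
  rewrite -big_distrr -big_distrl /=.
  have -> : ((\sum_f #|Af f|) * Q ^ k.+1 = Q ^ #|T| * (#|B| * Q ^ k))%N.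
    by rewrite expnS [LHS]mulnA [X in (X * _)%N]mulnC sumA mulnA.
  by rewrite leq_add2l.
pose pt j := odflt x0 [pick x in e j].
pose R := [set pt j | j in Df f].
exists (Af f :\: R); first by apply/fintype.subsetP => x; rewrite !inE => /and3P[].
split.
  move=> j jD; apply/negP => /fintype.subsetP h.
  have ptj : pt j \in e j.
    rewrite /pt; case: pickP => //= ej0; have := De j jD.
    by rewrite (eq_card0 ej0).
  have jDf : j \in Df f.
    rewrite inE jD; apply/fintype.subsetP => x /h.
    by rewrite inE => /andP[].
  by have := h _ ptj; rewrite inE /R imset_f.
have cR : (#|R| <= #|Df f|)%N by exact: leq_imset_card.
have cA : (#|Af f| <= #|Af f :\: R| + #|R|)%N.
  rewrite -(cardsID R (Af f)) addnC leq_add2l; apply: subset_leq_card.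
  exact: finset.subsetIr.
have : (#|Af f| * Q ^ k.+1 <= (#|Af f :\: R| + #|Df f|) * Q ^ k.+1)%N.
  by rewrite leq_mul2r (leq_trans cA) ?orbT // leq_add2l.
rewrite -/Q; move: hf; rewrite mulnDl [X in (_ + X <= _)%N]mulnC; lia.
Qed.

(** * The hypergraph of sumsets *)

Lemma leq_max_sumset_free (r : nat) (l : 'I_r -> nat) (n : nat)
    (A : {set 'I_n.+1}) :
  ord0 \notin A -> sumset_free l (ints A) -> (#|A| <= max_sumset_free l n)%N.
Proof.
move=> A0 freeA.
pose FA : {fset int} := [fset (nat_of_ord a)%:Z | a in A]%fset.
have memFA x : (x \in FA) <-> ints A x.
  split=> [/imfsetP[a aA ->]|[a aA ->]]; first by exists a.
  by apply/imfsetP; exists a.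
have cFA : #|` FA|%fset = #|A|.
  by rewrite card_imfset /= ?cardE // => a b [/val_inj].
rewrite -cFA /max_sumset_free.
apply: (@leq_bigmax_seq {fset int} (enum_fset (fpowerset (int_interval n)))
  (fun A0 : {fset int} => `[< sumset_free l [set` A0]%classic >])
  (fun A0 : {fset int} => #|` A0|%fset) FA).
  rewrite -/(FA \in fpowerset _) fpowersetE; apply/fsubsetP => x /memFA[a aA ->].
  apply/imfsetP; exists (a : nat) => //=; rewrite mem_iota add1n ltn_ord andbT.
  by rewrite lt0n; apply: contraNneq A0 => a0; rewrite -(_ : a = ord0) //; apply: val_inj.
apply/asboolP; rewrite (_ : [set` FA]%classic = ints A) //.
by apply/seteqP; split => x /memFA.
Qed.

Lemma max_sumset_free_gt0 (r : nat) (l : 'I_r -> nat) (n : nat) :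
  (0 < r)%N -> (forall i, 1 < l i)%N -> (0 < n)%N -> (0 < max_sumset_free l n)%N.
Proof.
move=> r0 l2 n0; pose A : {set 'I_n.+1} := [set inord 1]%SET.
have i1 : (inord 1 : 'I_n.+1) = 1%N :> nat by rewrite inordK.
have intsA x : ints A x -> x = 1 by case=> a /set1P -> ->; rewrite i1.
have <- : #|A| = 1%N by rewrite cards1.
apply: leq_max_sumset_free; first by rewrite inE -val_eqE /= i1.
case=> L [cL LA].
(* A singleton has no 3-term progression, so distinct choices of summands would
   give distinct sums in it. *)
have apA : ap3_free (ints A) by move=> x d /intsA h1 /intsA h2 _; lia.
have Lmem i m : (m < l i)%N -> nth 0 (enum_fset (L i)) m \in L i.
  by move=> ml; apply: mem_nth; rewrite cL.
pose a m i := nth 0 (enum_fset (L i)) m.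
have aL m : (m < 2)%N -> forall i, a m i \in L i.
  by move=> m2 i; apply: Lmem; apply: leq_trans (l2 i).
have s1 m : (m < 2)%N -> \sum_i a m i = 1.
  by move=> m2; apply: intsA; apply: LA; exists (a m); split => //; exact: aL.
have /(_ (Ordinal r0)) /eqP :=
  sumset_sums_inj apA LA (aL 0%N isT) (aL 1%N isT)
    (etrans (s1 0%N isT) (esym (s1 1%N isT))).
by rewrite nth_uniq ?fset_uniq // cL // ltnW // l2.
Qed.

(** A sumset is coded by the sum x of base points of the L i and by the
    differences from these base points of the other l i - 1 elements of each L i.
    Differences lie in [- n, n] and are stored with a shift by n.  Translating
    the L i without changing their sumset does not change the code; this is why
    the exponent of n in the number of codes is 1 + s instead of the sum of
    the l i. *)
Definition edge_code (n r : nat) (l : 'I_r -> nat) : finType :=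
  ('I_n.+1 * {ffun {i : 'I_r & 'I_(l i).-1} -> 'I_(2 * n).+1})%type.

Lemma card_edge_code (n r : nat) (l : 'I_r -> nat) :
  #|edge_code n r l| = (n.+1 * (2 * n).+1 ^ (\sum_(i < r) (l i).-1))%N.
Proof.
rewrite /edge_code card_prod card_ffun !card_ord card_tagged sumnE big_map big_enum /=.
by under eq_bigr do rewrite card_ord.
Qed.

(** The difference stored for the m-th element of the i-th summand; the 0-th
    element is the base point. *)
Definition offset {n r : nat} {l : 'I_r -> nat} (p : edge_code n r l)
    (i : 'I_r) (m : nat) : int :=
  if m is m'.+1 then
    if (insub m' : option 'I_(l i).-1) is Some j then
      (p.2 (Tagged (fun i => 'I_(l i).-1) j))%:Z - n%:Z
    else 0
  else 0.

Definition edge {n r : nat} {l : 'I_r -> nat} (p : edge_code n r l) :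
    {set 'I_n.+1} :=
  [set v : 'I_n.+1 | [exists h : {dffun forall i, 'I_(l i)},
     v%:Z == p.1%:Z + \sum_i offset p i (h i)]].

Lemma edge_code_bound (n s : nat) : (0 < n)%N ->
  (n.+1 * (2 * n).+1 ^ s * 2 <= 4 * 3 ^ s * n ^ s.+1)%N.
Proof.
move=> n0.
have h : ((2 * n).+1 ^ s <= 3 ^ s * n ^ s)%N.
  by rewrite -expnMn; case: s => // s; rewrite leq_exp2r //; lia.
rewrite expnS; apply: (@leq_trans (2 * n * (3 ^ s * n ^ s) * 2)); last by lia.
by rewrite leq_mul2r leq_mul //; lia.
Qed.

(** Two elements of the same summand differ by at most n, because completing
    them by the base points of the other summands gives two elements of A; so the
    differences fit into a code.  The edge has as many points as there are
    choices of summands, because equal sums come from equal summands. *)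
Lemma edge_of_sumset {n r : nat} {l : 'I_r -> nat} {L : 'I_r -> {fset int}}
    {A : {set 'I_n.+1}} :
  (forall i, 0 < l i)%N -> (forall i, #|` L i|%fset = l i) ->
  ap3_free (ints A) -> (sumset L `<=` ints A)%classic ->
  exists2 p : edge_code n r l,
    edge p \subset A & (\prod_(i < r) l i <= #|edge p|)%N.
Proof.
move=> l0 cL apA LA.
pose a (i : 'I_r) (m : nat) := nth 0 (enum_fset (L i)) m.
have aL i m : (m < l i)%N -> a i m \in L i.
  by move=> ml; apply: mem_nth; rewrite cL.
have inA (u : 'I_r -> int) : (forall i, u i \in L i) -> ints A (\sum_i u i).
  by move=> uL; apply: LA; exists u.
have [b bA bE] := inA (fun i => a i 0%N) (fun i => aL i 0%N (l0 i)).
have range i m : (m < l i)%N -> - n%:Z <= a i m - a i 0%N <= n%:Z.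
  move=> ml.
  have [|c cA] := inA (fun j => if j == i then a i m else a j 0%N).
    by move=> j; case: eqP => [->|_]; apply: aL.
  rewrite (bigD1 i) //= eqxx (eq_bigr (fun j => a j 0%N)); last first.
    by move=> j /negPf ->.
  move: bE; rewrite (bigD1 i) //=; have := ltn_ord b; have := ltn_ord c.
  lia.
pose g : {ffun {i : 'I_r & 'I_(l i).-1} -> 'I_(2 * n).+1} :=
  [ffun t : {i : 'I_r & 'I_(l i).-1} =>
     inord (absz (a (tag t) (tagged t).+1 - a (tag t) 0%N + n%:Z))].
pose p : edge_code n r l := (b, g).
have offE i m : (m < l i)%N -> offset p i m = a i m - a i 0%N.
  case: m => [|m] ml; first by rewrite subrr.
  rewrite /offset insubT; first by rewrite -ltnS prednK.
  move=> ml'; rewrite ffunE /= inordK; have := range i m.+1 ml; lia.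
have sumE (h : {dffun forall i, 'I_(l i)}) :
    p.1%:Z + \sum_i offset p i (h i) = \sum_i a i (h i).
  under eq_bigr do rewrite offE //.
  by rewrite /= sumrB bE addrC subrK.
have hA (h : {dffun forall i, 'I_(l i)}) : ints A (\sum_i a i (h i)).
  by apply: inA => i; exact: aL.
exists p.
  apply/fintype.subsetP => v; rewrite inE => /existsP[h /eqP]; rewrite sumE.
  by have [c cA ->] := hA h; case=> /val_inj ->.
pose f (h : {dffun forall i, 'I_(l i)}) : 'I_n.+1 := inord (absz (\sum_i a i (h i))).
have fE h : (f h)%:Z = \sum_i a i (h i).
  by have [c cA cE] := hA h; rewrite /f cE /= inord_val.
have f_inj : injective f.
  move=> h h' /(congr1 (fun v : 'I_n.+1 => v%:Z)); rewrite !fE => e.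
  apply/ffunP => i; apply: val_inj; apply/eqP.
  have := sumset_sums_inj apA LA (fun i => aL i _ (ltn_ord (h i)))
    (fun i => aL i _ (ltn_ord (h' i))) e i.
  by move=> /eqP; rewrite nth_uniq ?fset_uniq // cL.
have <- : #|[set f h | h in {dffun forall i, 'I_(l i)}]| = (\prod_(i < r) l i)%N.
  rewrite card_imset // card_dep_ffun foldrE big_map big_enum /=.
  by under eq_bigr do rewrite card_ord.
apply: subset_leq_card; apply/fintype.subsetP => _ /imsetP[h _ ->].
by rewrite inE; apply/existsP; exists h; rewrite fE sumE.
Qed.

Lemma max_sumset_free_alteration (r : nat) (l : 'I_r -> nat) (n k q : nat)
    (B : {set 'I_n.+1}) :
  (forall i, 0 < l i)%N -> (\prod_(i < r) l i = k.+1)%N ->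
  ap3_free (ints B) -> ord0 \notin B ->
  (#|B| * q.+1 ^ k <= max_sumset_free l n * q.+1 ^ k.+1
     + n.+1 * (2 * n).+1 ^ (\sum_(i < r) (l i).-1))%N.
Proof.
move=> l0 lk apB B0.
(* A sumset inside B is represented by an edge with at least k + 1 points, so it
   is enough to destroy these. *)
pose D := [set p : edge_code n r l | (k < #|edge p|)%N].
have Dk p : p \in D -> (k < #|edge p|)%N by rewrite inE.
have [A AB [freeA cA]] := alteration ord0 B edge D k q Dk.
have ABi : (ints A `<=` ints B)%classic.
  by move=> x [a aA ->]; exists a => //; exact: (fintype.subsetP AB).
apply: (leq_trans cA); apply: leq_add; last first.
  by rewrite -card_edge_code max_card.
rewrite leq_mul2r; apply/orP; right; apply: leq_max_sumset_free.
  by apply: contra B0; exact: (fintype.subsetP AB).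
case=> L [cL LA].
have [p pA pk] := edge_of_sumset l0 cL (sub_ap3_free ABi apB) LA.
have pD : p \in D by rewrite inE -lk.
by have := freeA p pD; rewrite pA.
Qed.

(** * Asymptotics *)

Local Open Scope classical_set_scope.

Lemma near_le_powR {R : realType} (c a : R) : 0 < a ->
  \forall n \near \oo, c <= n%:R `^ a.
Proof.
move=> a0; near=> n; apply: (le_trans (ler_norm c)).
have -> : `|c| = (`|c| `^ a^-1) `^ a by rewrite -powRrM mulVf ?gt_eqF // powRr1.
apply: ge0_ler_powR; rewrite ?nnegrE ?powR_ge0 ?ler0n ?(ltW a0) //.
near: n; exact: nbhs_infty_ger.
Unshelve. all: by end_near. Qed.

Lemma behrend_powR {R : realType} (a : R) : 0 < a ->
  \forall n \near \oo, exists B : {set 'I_n.+1},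
    [/\ ap3_free (ints B), ord0 \notin B & n%:R `^ (1 - a) <= #|B|%:R :> R].
Proof.
move=> a0.
(* The dimension makes the loss n^(2 / k) at most n^(a / 2); the other half of
   the exponent a absorbs the constant 4^k k. *)
pose k := (Num.truncn (4 / a)).+1.
have k0 : (0 : R) < k%:R by rewrite ltr0n.
have ka : 2 / k%:R <= a / 2.
  have : 4 / a < k%:R by exact: truncnS_gt.
  rewrite ltr_pdivrMr // => h; rewrite ler_pdivrMr //; lra.
near=> n.
have n1 : (1 : R) <= n%:R.
  by rewrite ler1n; near: n; exact: nbhs_infty_gt.
have nk : (2 ^ k <= n)%N by near: n; exact: nbhs_infty_ge.
have n0 : (0 : R) < n%:R by exact: lt_le_trans n1.
have nz0 : n%:R != 0 :> R by rewrite gt_eqF.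
have cn : (4 ^ k * k)%:R <= n%:R `^ (a / 2) :> R.
  by near: n; apply: near_le_powR; rewrite divr_gt0.
have [d [B [apB B0 dn nB]]] := @behrend n k isT nk.
exists B; split => //.
have d2 : (d ^ 2)%:R <= n%:R `^ (a / 2) :> R.
  apply: le_trans (ler_powR n1 ka).
  have -> : (d ^ 2)%:R = (d ^ k)%:R `^ (2 / k%:R) :> R.
    rewrite !natrX -(powR_mulrn k) // -powRrM.
    by rewrite mulrCA divff ?gt_eqF // mulr1 powR_mulrn.
  by apply: ge0_ler_powR; rewrite ?nnegrE ?ler_nat // divr_ge0 // ltW.
rewrite powRB ?nz0 ?implybT // powRr1 ?ler0n // ler_pdivrMr ?powR_gt0 //.
have -> : n%:R `^ a = n%:R `^ (a / 2) * n%:R `^ (a / 2) :> R.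
  by rewrite -powRD ?nz0 ?implybT //; congr powR; field.
have : n%:R <= (4 ^ k * k)%:R * (d ^ 2)%:R * #|B|%:R :> R.
  by rewrite -!natrM ler_nat; move: nB; rewrite !mulnA.
move=> /le_trans; apply; rewrite mulrC ler_wpM2l //.
by apply: ler_pM.
Unshelve. all: by end_near. Qed.

(** The density 1 / (q + 1), with q + 1 close to n^g for g = (s + 2 b) / k, is
    small enough that the number of codes, of order n^(1 + s), is at most half
    of |B| (q + 1)^k when |B| >= n^(1 - b).  Then F(n) >= |B| / (2 (q + 1)), which
    is n^(1 - b - g) up to a constant; the loss with respect to
    1 - s / k is b + 2 b / k, plus b for the constants. *)
Lemma max_sumset_free_powR {R : realType} (r : nat) (l : 'I_r -> nat) (k : nat)
    (a : R) :
  (forall i, 0 < l i)%N -> (\prod_(i < r) l i = k.+1)%N -> (0 < k)%N -> 0 < a ->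
  \forall n \near \oo,
    n%:R `^ (1 - (\sum_(i < r) (l i).-1)%N%:R / k%:R - a)
      <= (max_sumset_free l n)%:R :> R.
Proof.
move=> l0 lk k0 a0; set s := (\sum_(i < r) (l i).-1)%N.
pose b := a / 4; have b0 : 0 < b by rewrite /b; lra.
pose g := (s%:R + 2 * b) / k%:R.
have kR : (1 : R) <= k%:R by rewrite ler1n.
have kR0 : (0 : R) < k%:R by exact: lt_le_trans kR.
have g0 : 0 <= g by rewrite /g divr_ge0 // addr_ge0 // mulr_ge0 // ltW.
near=> n.
have n1 : (1 <= n)%N by near: n; exact: nbhs_infty_gt.
have x1 : (1 : R) <= n%:R by rewrite ler1n.
have cb : (4 * 3 ^ s)%:R <= n%:R `^ b :> R by near: n; exact: near_le_powR.
have [B [apB B0 cB]] : exists B : {set 'I_n.+1},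
    [/\ ap3_free (ints B), ord0 \notin B & n%:R `^ (1 - b) <= #|B|%:R :> R].
  by near: n; exact: behrend_powR.
set x : R := n%:R in x1 cb cB *.
have x0 : 0 < x by exact: lt_le_trans x1.
have nz0 : x != 0 by rewrite gt_eqF.
have xD u v : x `^ (u + v) = x `^ u * x `^ v by rewrite powRD ?nz0 ?implybT //.
pose q := Num.truncn (x `^ g).
have xg1 : 1 <= x `^ g by rewrite -(powRr0 x) ler_powR.
have qgt : x `^ g < q.+1%:R by exact: truncnS_gt.
have qle : q.+1%:R <= 2 * x `^ g.
  rewrite mulr2n mulrDl mul1r -natr1 lerD // truncn_le.
  exact: ltW (lt_le_trans ltr01 xg1).
have Q0 : (0 : R) < q.+1%:R by rewrite ltr0n.
set F := max_sumset_free l n.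
have main := max_sumset_free_alteration r l n k q B l0 lk apB B0.
have Qk : x `^ (s%:R + 2 * b) <= q.+1%:R ^+ k.
  have -> : s%:R + 2 * b = g * k%:R by rewrite /g divfK ?gt_eqF.
  rewrite powRrM powR_mulrn ?powR_ge0 //.
  by apply: lerXn2r; rewrite ?nnegrE ?powR_ge0 ?ler0n //; exact: ltW.
have NQ : (4 * 3 ^ s)%:R * x ^+ s.+1 <= #|B|%:R * q.+1%:R ^+ k :> R.
  apply: (@le_trans _ _ (x `^ (1 - b) * x `^ (s%:R + 2 * b))); last first.
    by apply: ler_pM; rewrite ?powR_ge0.
  rewrite -xD (_ : 1 - b + (s%:R + 2 * b) = b + s.+1%:R); last by rewrite -natr1; ring.
  by rewrite xD powR_mulrn ?(ltW x0) // ler_wpM2r // exprn_ge0 // (ltW x0).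
have M : (n.+1 * (2 * n).+1 ^ s)%:R * 2 <= (4 * 3 ^ s)%:R * x ^+ s.+1.
  by rewrite /x -natrX -!natrM ler_nat edge_code_bound.
have two : #|B|%:R * q.+1%:R ^+ k <= 2 * F%:R * q.+1%:R * q.+1%:R ^+ k :> R.
  have : #|B|%:R * q.+1%:R ^+ k <= F%:R * q.+1%:R ^+ k.+1 +
     (n.+1 * (2 * n).+1 ^ s)%:R :> R.
    by rewrite -!natrX -!natrM -natrD ler_nat.
  rewrite exprS; nra.
have {two} two : #|B|%:R <= 4 * F%:R * x `^ g :> R.
  move: two; rewrite ler_pM2r ?exprn_gt0 // => /le_trans; apply.
  have -> : 4 * F%:R * x `^ g = 2 * F%:R * (2 * x `^ g) by ring.
  by rewrite ler_wpM2l // mulr_ge0.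
have c4 : 4 <= x `^ b.
  by apply: le_trans cb; rewrite natrM ler_peMr // ler1n expn_gt0.
have fin : x `^ (1 - b) <= F%:R * x `^ (b + g).
  rewrite (xD b g) mulrA; apply: (le_trans cB); apply: (le_trans two).
  by rewrite ler_wpM2r ?powR_ge0 // mulrC ler_wpM2l.
have : x `^ (1 - b - (b + g)) <= F%:R.
  by rewrite powRB ?nz0 ?implybT // ler_pdivrMr ?powR_gt0.
apply: le_trans; apply: ler_powR => //.
have : 2 * b / k%:R <= 2 * b by rewrite ler_pdivrMr // ler_peMr // mulr_ge0 // ltW.
rewrite /g mulrDl /b; lra.
Unshelve. all: by end_near. Qed.

Theorem theorem2 (R : realType) (r : nat) (l : 'I_r -> nat)
    (r_ge2 : (2 <= r)%N)
    (l_ge2 : forall i, (2 <= l i)%N)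
    (l_mono : forall i j : 'I_r, (i <= j)%N -> (l i <= l j)%N) :
  exists2 e : nat -> R, e @ \oo --> (0 : R) &
    forall n : nat, (1 <= n)%N ->
      (n%:R : R) `^ (1 - ((\sum_(i < r) l i)%N%:R - r%:R)
                         / ((\prod_(i < r) l i)%N%:R - 1) - e n)
      <= (max_sumset_free l n)%:R.
Proof.
have l_gt0 i : (0 < l i)%N by exact: ltnW.
have r_gt0 : (0 < r)%N by exact: ltnW.
have [k lk k0] : exists2 k, (\prod_(i < r) l i = k.+1)%N & (0 < k)%N.
  have : (1 < \prod_(i < r) l i)%N.
    rewrite (bigD1 (Ordinal r_gt0)) //=; apply: (@leq_trans (l (Ordinal r_gt0))) => //.
    by rewrite leq_pmulr // prodn_gt0.
  by case: (\prod_(i < r) l i)%N => // k; exists k.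
have sumE : (\sum_(i < r) l i)%N%:R - r%:R = (\sum_(i < r) (l i).-1)%N%:R :> R.
  have -> : (\sum_(i < r) l i = \sum_(i < r) (l i).-1 + r)%N.
    rewrite -[X in (_ + X)%N]card_ord -sum1_card -big_split /=.
    by apply: eq_bigr => i _; rewrite addn1 prednK.
  by rewrite natrD addrK.
rewrite sumE lk -natr1 addrK.
set al := 1 - _ / _.
pose F n : R := (max_sumset_free l n)%:R.
have F1 n : (0 < n)%N -> 1 <= F n by move=> n0; rewrite ler1n max_sumset_free_gt0.
(* The exact error exponent, truncated at 0 because only a lower bound on
   F is known, which does not control how negative it is.  At n = 1 the
   quotient is by 0, but 1 to any power is 1. *)
exists (fun n => Num.max 0 (al - ln (F n) / ln n%:R)).
  apply/cvgrPdist_le => a a0; near=> n.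
  have n1 : (1 < n)%N by near: n; exact: nbhs_infty_gt.
  have lnn : 0 < ln n%:R :> R by rewrite ln_gt0 // ltr1n.
  have Fn0 : 0 < F n by apply: lt_le_trans (F1 _ _) => //; exact: ltnW.
  have n0 : (0 : R) < n%:R by rewrite ltr0n ltnW.
  have h : n%:R `^ (al - a) <= F n by near: n; exact: max_sumset_free_powR.
  rewrite sub0r normrN ger0_norm ?le_max ?lexx // ge_max (ltW a0) /=.
  rewrite lerBlDr -lerBlDl ler_pdivlMr // -ln_powR.
  by rewrite ler_ln // posrE powR_gt0.
move=> n n1; have [n2|n2] := ltnP 1 n; last first.
  have -> : n = 1%N by apply/eqP; rewrite eqn_leq n2 n1.
  by rewrite powR1; exact: F1.
have lnn : 0 < ln n%:R :> R by rewrite ln_gt0 // ltr1n.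
have Fn0 : 0 < F n by apply: lt_le_trans (F1 _ _).
have n0 : (0 : R) < n%:R by rewrite ltr0n.
rewrite -ler_ln ?posrE ?powR_gt0 // ln_powR -ler_pdivlMr //.
by rewrite lerBlDr -lerBlDl le_max lexx orbT.
Unshelve. all: by end_near. Qed.
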